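(* Let $G$ be an amenable group, $\mathcal{F} = (F_j)_{j \in J}$ a right F\o lner net for $G$, and $V$ a finite-dimensional vector space over a field $\mathbb{K}$. Let $X \subset V^G$ be a strongly irreducible linear subshift and $Y \subset V^G$ a linear subshift such that $Y \subsetneqq X$. Then one has $\operatorname{mdim}_{\mathcal{F}}(Y) < \operatorname{mdim}_{\mathcal{F}}(X)$.
   Context: $V^G$ is the set of all maps (configurations) $x \colon G \to V$, with its product $\mathbb{K}$-vector space structure, the prodiscrete topology (product of the discrete topologies on the factors $V$), and the left $G$-action $(gx)(h) = x(g^{-1}h)$. A linear subshift is a closed $G$-invariant vector subspace of $V^G$. Strong irreducibility: for a finite subset $\Delta \subset G$, a subshift $X$ is $\Delta$-irreducible if, whenever $\Omega_1,\Omega_2$ are finite subsets of $G$ such that there is no $g \in \Omega_2$ with $g\Delta \cap \Omega_1 \neq \varnothing$, then for all $x_1,x_2 \in X$ there is $x \in X$ with $x\vert_{\Omega_1} = x_1\vert_{\Omega_1}$ and $x\vert_{\Omega_2} = x_2\vert_{\Omega_2}$. $X$ is strongly irreducible if it is $\Delta$-irreducible for some finite $\Delta \subset G$. For $E,\Omega \subset G$, $\Omega^{+E} = \{g \in G : gE \cap \Omega \neq \varnothing\} = \Omega E^{-1}$. A right F\o lner net for $G$ is a net $(F_j)_{j\in J}$ (indexed by a directed set $J$) of nonempty finite subsets of $G$ such that $\lim_j |F_j^{+E} \setminus F_j|/|F_j| = 0$ for every finite $E \subset G$. For $\Omega \subset G$, $\pi_\Omega \colon V^G \to V^\Omega$ is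 the restriction (projection) map. The mean dimension of a vector subspace $X \subset V^G$ with respect to $\mathcal{F}$ is $\operatorname{mdim}_{\mathcal{F}}(X) = \limsup_j \dim(\pi_{F_j}(X))/|F_j|$. *)

(* Defs.v *)
From mathcomp Require Import all_boot all_order all_algebra.
From mathcomp Require Import finmap.
From mathcomp Require Import all_classical all_reals all_analysis.

Set Implicit Arguments.
Unset Strict Implicit.
Unset Printing Implicit Defensive.

Import Order.TTheory GRing.Theory Num.Theory.
Import numFieldNormedType.Exports.

Local Open Scope classical_set_scope.
Local Open Scope ring_scope.

Definition ltranslate (G : groupType) (g : G) (E : {fset G}) : {fset G} :=
  [fset (g * e)%g | e in E]%fset.

(* Omega^{+E}, given by the formula Omega E^{-1} *)
Definition thickening (G : groupType) (Omega E : {fset G}) : {fset G} :=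
  [fset (w * e^-1)%g | w in Omega, e in E]%fset.

Lemma thickeningP (G : groupType) (Omega E : {fset G}) (g : G) :
  (g \in thickening Omega E) = ((ltranslate g E `&` Omega)%fset != fset0).
Proof.
apply/imfset2P/fset0Pn => [[w /= wO [e /= eE ->]]|[x]].
- exists w; rewrite !inE wO andbT; apply/imfsetP; exists e => //=.
  by rewrite mulgVK.
- rewrite inE => /andP[/imfsetP[e /= eE xE] xO].
  by exists x => //; exists e => //; rewrite xE mulgK.
Qed.

(* a left-invariant finitely additive probability measure on all subsets *)
Definition amenable (R : realType) (G : groupType) : Prop :=
  exists m : set G -> R,
    [/\ m setT = 1,
        (forall A, 0 <= m A),
        (forall A B, A `&` B = set0 -> m (A `|` B) = m A + m B) &
        (forall (g : G) A, m [set (g * a)%g | a in A] = m A)].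

Definition directed (d : Order.disp_t) (J : preorderType d) : Prop :=
  [set: J] !=set0 /\
  forall i j : J, exists k : J, (i <= k)%O /\ (j <= k)%O.

Definition tails (d : Order.disp_t) (J : preorderType d) : set_system J :=
  filter_from [set: J] (fun i => [set j | (i <= j)%O]).
Arguments tails {d} J _.

(* [limf_esup] wants its domain to carry neighbourhoods, whose choice is
   irrelevant to its value; hence the cast to [discrete_topology J]. *)
Definition net_limsup (R : realType) (d : Order.disp_t) (J : preorderType d)
    (u : J -> \bar R) : \bar R :=
  limf_esup (u : discrete_topology J -> \bar R) (tails J).

Lemma net_limsupE (R : realType) (d : Order.disp_t) (J : preorderType d)
    (u : J -> \bar R) :
  net_limsup u = ereal_inf
    [set ereal_sup [set u j | j in [set j | (i <= j)%O]] | i in [set: J]].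
Proof.
apply/eqP; rewrite eq_le; apply/andP; split.
- apply: le_ereal_inf => _ [i _ <-]; exists [set j | (i <= j)%O] => //.
  by exists i.
- apply: le_ereal_inf_tmp => _ [A [i _ iA] <-].
  apply: (@le_trans _ _ (ereal_sup [set u j | j in [set j | (i <= j)%O]])).
    by apply: ereal_inf_lbound; exists i.
  by apply: ereal_sup_le => _ [j ij <-]; exists j => //; apply: iA.
Qed.

Definition right_folner_net (R : realType) (G : groupType)
    (d : Order.disp_t) (J : preorderType d) (F : J -> {fset G}) : Prop :=
  [/\ directed J,
      (forall j, F j != fset0) &
      forall E : {fset G},
        (fun j => (#|` (thickening (F j) E `\` F j)%fset|)%:R
                  / (#|` F j|)%:R : R) @ tails J --> (0 : R)].

Definition gshift (G : groupType) (V : Type) (g : G) (x : G -> V) : G -> V :=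
  fun h => x (g^-1 * h)%g.

Definition linear_subshift (G : groupType) (K : fieldType) (V : vectType K)
    (X : set (G -> V)) : Prop :=
  [/\ submod_closed (mem X),
      (forall g x, X x -> X (gshift g x)) &
      closed (X : set {ptws G -> discrete_topology V})].

Definition irreducible_for (G : groupType) (V : Type) (Delta : {fset G})
    (X : set (G -> V)) : Prop :=
  forall Omega1 Omega2 : {fset G},
    ~ (exists2 g, g \in Omega2 &
        (ltranslate g Delta `&` Omega1)%fset != fset0) ->
    forall x1 x2, X x1 -> X x2 ->
      exists2 x, X x & {in Omega1, x =1 x1} /\ {in Omega2, x =1 x2}.

Definition strongly_irreducible (G : groupType) (V : Type)
    (X : set (G -> V)) : Prop :=
  exists Delta : {fset G}, irreducible_for Delta X.

(* The dimension of a set of vectors that is a linear subspace;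
   0 for a set that is not (see [setdim_vspace]). *)
Definition setdim (K : fieldType) (U : vectType K) (W : set U) : nat :=
  \dim (xget 0%VS [set E : {vspace U} | W = [set` E]]).

Lemma setdimE (K : fieldType) (U : vectType K) (E : {vspace U}) :
  setdim [set` E] = \dim E.
Proof.
rewrite /setdim; case: xgetP => [D _ /= ED|/(_ E erefl)//].
congr (\dim _); apply/vspaceP => v.
have /= vED := congr1 (@^~ v) ED.
by apply/idP/idP; rewrite vED.
Qed.

Lemma setdim_vspace (K : fieldType) (U : vectType K) (W : set U) :
  submod_closed (mem W) -> exists E : {vspace U}, W = [set` E].
Proof.
move=> [W0 Wl].
have Wlin a u v : W u -> W v -> W (a *: u + v).
  by move=> Wu Wv; move: (Wl a u v); rewrite !inE; apply.
have W0' : W 0 by move: W0; rewrite inE.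
pose P n := `[< exists2 E : {vspace U}, [set` E] `<=` W & \dim E = n >].
have exP : exists n, P n.
  exists 0%N; apply/asboolP; exists 0%VS; last exact: dimv0.
  by move=> v /=; rewrite memv0 => /eqP ->.
have leP n : P n -> (n <= \dim {:U})%N.
  by move=> /asboolP[E _ <-]; apply: dimvS; apply: subvf.
case: (ex_maxnP exP leP) => _ /asboolP[E EW <-] maxE.
exists E; apply/seteqP; split=> // v Wv /=.
apply: contrapT => /negP vE.
have/maxE : P (\dim (<[v]> + E)%VS).
  apply/asboolP; exists (<[v]> + E)%VS => // _ /memv_addP[_ /vlineP[k ->] [w wE ->]].
  by apply: Wlin => //; apply: EW.
apply/negP; rewrite -ltnNge; apply: contraR vE; rewrite -leqNgt => dE.
have sE : (E <= <[v]> + E)%VS by apply: addvSr.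
have /eqP -> : E == (<[v]> + E)%VS by rewrite eqEdim sE dE.
by apply: (subvP (addvSl _ _)); apply: memv_line.
Qed.

Definition restriction (G : choiceType) (V : Type) (Omega : {fset G})
    (x : G -> V) : {ffun Omega -> V} :=
  [ffun i => x (val i)].

Definition mdim (R : realType) (G : groupType) (K : fieldType)
    (V : vectType K) (d : Order.disp_t) (J : preorderType d)
    (F : J -> {fset G}) (X : set (G -> V)) : \bar R :=
  net_limsup (fun j =>
    ((setdim (@restriction G V (F j) @` X))%:R / (#|` F j|)%:R)%:E).

(* Main.v *)
Require Import Defs.
From mathcomp Require Import all_boot all_order all_algebra.
From mathcomp Require Import finmap.
From mathcomp Require Import all_classical all_reals all_analysis.
From mathcomp Require Import ring lra.

Set Implicit Arguments.
Unset Strict Implicit.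
Unset Printing Implicit Defensive.

Import Order.TTheory GRing.Theory Num.Theory.
Import numFieldNormedType.Exports.

Local Open Scope classical_set_scope.
Local Open Scope ring_scope.

(** Since [Y] is closed, some [x0] in [X] is told apart from all of [Y] by a
    finite window [Omega] ([closed_prodiscrete_separated]); by invariance the
    translate of [x0] by [g] is told apart from [Y] on [g Omega].  Each window
    [g Omega] inside a finite set [F] is thus a place where [X] has more freedom
    than [Y], and strong irreducibility makes these freedoms independent when
    the windows are far apart.

    More precisely, take windows with centres [g_1, ..., g_n], listed so that
    no [g_j] lies in [g_i Omega Delta Omega^-1] for [i < j].  Irreducibility
    yields an [x] in [X] that equals the translate of [x0] on [g_1 Omega] and
    vanishes on the other windows.  Among the configurations of [X] that look
    like elements of [Y] on the windows 2 to [n], this [x] witnesses that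
    requiring the same on the first window is a strict restriction, still
    visible after projecting to [F].  Hence, by induction on [n],
    [dim (pi_F Y) + n <= dim (pi_F X)] ([setdim_locally_in]).

    A greedy choice of centres ([greedy_packing]) reaches a fixed proportion of
    all [g] with [g Omega] inside [F], and these [g] fill [F] up to a
    multiple of the boundary of [F] ([card_tile_centers]).  Along a Folner net
    the boundary is negligible, so the normalized dimensions of [Y] and [X]
    eventually differ by at least a fixed [e > 0].  They are bounded, hence the
    upper limits differ as well ([net_limsup_lt]). *)

(** * Dimensions of sets of vectors *)

Lemma submod_closedP (K : fieldType) (U : lmodType K) (W : set U) :
  submod_closed (mem W) <->
  W 0 /\ forall a u v, W u -> W v -> W (a *: u + v).
Proof.
split=> [[W0 Wl]|[W0 Wl]].
  split=> [|a u v Wu Wv]; first by move: W0; rewrite inE.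
  by move: (Wl a u v); rewrite !inE; apply.
split=> [|a u v]; rewrite !inE //; exact: Wl.
Qed.

Lemma ltn_setdim (K : fieldType) (U : vectType K) (W1 W2 : set U) :
  submod_closed (mem W1) -> submod_closed (mem W2) -> W1 `<` W2 ->
  (setdim W1 < setdim W2)%N.
Proof.
move=> /setdim_vspace[E1 ->] /setdim_vspace[E2 ->] [s21 s12].
rewrite !setdimE ltnNge; apply/negP => le21; apply: s12.
have s12 : (E1 <= E2)%VS by apply/subvP.
have /eqP <- : E1 == E2 by rewrite eqEdim s12.
exact: subset_refl.
Qed.

Lemma setdim_le_dim (K : fieldType) (U : vectType K) (W : set U) :
  (setdim W <= dim U)%N.
Proof. by rewrite /setdim -dimvf dimvS // subvf. Qed.

Lemma leq_setdim (K : fieldType) (U : vectType K) (W1 W2 : set U) :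
  submod_closed (mem W1) -> submod_closed (mem W2) -> W1 `<=` W2 ->
  (setdim W1 <= setdim W2)%N.
Proof.
move=> /setdim_vspace[E1 ->] /setdim_vspace[E2 ->] s12.
by rewrite !setdimE dimvS //; apply/subvP.
Qed.

Lemma restriction_submod (G : choiceType) (K : fieldType) (V : vectType K)
    (F : {fset G}) (X : set (G -> V)) :
  submod_closed (mem X) -> submod_closed (mem (@restriction G V F @` X)).
Proof.
move=> /submod_closedP[X0 Xl]; apply/submod_closedP; split.
  by exists 0 => //; apply/ffunP => i; rewrite !ffunE.
move=> a _ _ [x Xx <-] [y Xy <-]; exists (a *: x + y); first exact: Xl.
by apply/ffunP => i; rewrite !ffunE.
Qed.

(** * Separation by a finite window *)

(** The cylinders around [x] form a filter base, and the filter they generate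
    converges to [x] because each coordinate is eventually constant along it;
    so if every cylinder met [Y], then [x] would be in the closure of [Y]. *)
Lemma closed_prodiscrete_separated (G V : choiceType) (Y : set (G -> V)) (x : G -> V) :
  closed (Y : set {ptws G -> discrete_topology V}) -> ~ Y x ->
  exists Omega : {fset G}, ~ exists2 y, Y y & {in Omega, y =1 x}.
Proof.
move=> cY nYx; apply: contrapT => /forallNP nsep; apply: nYx.
have {}nsep (Omega : {fset G}) : exists2 y, Y y & {in Omega, y =1 x}.
  exact: contrapT (nsep Omega).
apply: cY => B nB.
pose cyl (Omega : {fset G}) := [set y : G -> V | {in Omega, y =1 x}].
pose Phi := filter_from [set: {fset G}] cyl.
have PhiF : Filter Phi.
  apply: filter_from_filter; first by exists fset0.
  move=> A C _ _; exists (A `|` C)%fset => // y yAC.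
  by split=> g gA; apply: yAC; rewrite inE gA ?orbT.
have : cvg_to Phi (nbhs (x : {ptws G -> discrete_topology V})).
  apply/cvg_sup => g U [/= _ [[W /= oW <-] /= Wx WU]].
  exists [fset g]%fset => // y /(_ g) yx; apply: WU => /=.
  by rewrite /proj yx // inE.
move=> /(_ B nB) [W _ WB]; have [y Yy yx] := nsep W.
by exists y; split => //; apply: WB.
Qed.

(** * Packing windows into a finite set *)

Lemma card_thickening (G : groupType) (A B : {fset G}) :
  (#|` thickening A B| <= #|` A| * #|` B|)%N.
Proof.
apply: (@leq_trans (size [seq (a * b^-1)%g | a <- A, b <- B])); last first.
  by rewrite size_allpairs.
apply: uniq_leq_size; first exact: fset_uniq.
by move=> _ /imfset2P[a /= aA [b /= bB ->]]; apply/allpairsP; exists (a, b).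
Qed.

Lemma card_ltranslate (G : groupType) (g : G) (A : {fset G}) :
  (#|` ltranslate g A| <= #|` A|)%N.
Proof. exact: leq_imfset_card. Qed.

(** Choosing [g] in [I], discarding [g D] and repeating costs at most [#|D|]
    elements per choice.  Only later centres are kept away from earlier ones,
    an asymmetric condition that suffices below and spares making [D]
    symmetric. *)
Lemma greedy_packing (G : groupType) (D I : {fset G}) :
  1%g \in D ->
  exists s : seq G, [/\ {subset s <= I},
    pairwise (fun a b => b \notin ltranslate a D) s &
    (#|` I| <= size s * #|` D|)%N].
Proof.
move=> D1; have [n] := ubnP #|` I|; elim: n I => // n IH I.
have [-> _|/fset0Pn[g gI]] := eqVneq I fset0.
  by exists [::]; split => //; rewrite cardfs0.
rewrite ltnS => leIn.
have gD : g \in ltranslate g D by apply/imfsetP; exists 1%g; rewrite ?mulg1.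
have prI : (I `\` ltranslate g D `<` I)%fset.
  rewrite fproperEneq fsubsetDl andbT; apply/eqP => eqI.
  by move: gI; rewrite -eqI inE gD.
have [s [sI sD cI]] := IH _ (leq_trans (fproper_ltn_card prI) leIn).
exists (g :: s); split.
- move=> h; rewrite inE => /predU1P[-> //|/sI].
  by rewrite inE => /andP[].
- rewrite /= sD andbT; apply/allP => h /sI.
  by rewrite inE => /andP[].
- rewrite -(cardfsID (ltranslate g D) I) /= mulSn leq_add //.
  by rewrite (leq_trans _ (card_ltranslate g D)) // fsubset_leq_card // fsubsetIr.
Qed.

Definition tile_centers (G : groupType) (Omega F : {fset G}) : {fset G} :=
  [fset g in F | (ltranslate g Omega `<=` F)%fset]%fset.

(** If [g] is in [F] but [g w] is not, then [g w] is a boundary point, and [g]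
    is recovered from it and [w]. *)
Lemma card_tile_centers (G : groupType) (Omega F : {fset G}) :
  (#|` F| <= #|` tile_centers Omega F| + #|` Omega| *
     #|` (thickening F [fset w^-1 | w in Omega]%g `\` F)%fset|)%N.
Proof.
rewrite -(cardfsID (tile_centers Omega F) F) leq_add //.
  by rewrite fsubset_leq_card // fsubsetIr.
rewrite mulnC; apply: leq_trans (card_thickening _ _).
apply/fsubset_leq_card/fsubsetP => g.
rewrite !inE /= => /andP[+ gF]; rewrite gF /= => /fsubsetPn[_ /imfsetP[w /= wO ->] gwF].
apply/imfset2P; exists (g * w)%g; last by exists w => //; rewrite mulgK.
rewrite !inE gwF /=; apply/imfset2P; exists g => //; exists w^-1%g; last by rewrite invgK.
by apply/imfsetP; exists w.
Qed.

(** * Loss of dimension on separated windows *)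

Definition locally_in (G : groupType) (V : Type) (Y : set (G -> V)) (Omega : {fset G})
    (s : seq G) (X : set (G -> V)) : set (G -> V) :=
  [set x | X x /\ forall g, g \in s ->
     exists2 y, Y y & {in ltranslate g Omega, x =1 y}].

Lemma locally_in_submod (G : groupType) (K : fieldType) (V : vectType K)
    (X Y : set (G -> V)) Omega s :
  submod_closed (mem X) -> submod_closed (mem Y) ->
  submod_closed (mem (locally_in Y Omega s X)).
Proof.
move=> /submod_closedP[X0 Xl] /submod_closedP[Y0 Yl]; apply/submod_closedP; split.
  by split=> // g gs; exists 0.
move=> a u v [Xu Yu] [Xv Yv]; split; first exact: Xl.
move=> g gs; have [y Yy uy] := Yu g gs; have [z Yz vz] := Yv g gs.
exists (a *: y + z); first exact: Yl.
by move=> h hO; rewrite /GRing.add/= /GRing.scale/= uy ?vz.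
Qed.

(** [h] lies in [g Omega Delta Omega^-1] exactly when some [k] in [g Omega] has
    [k Delta] meeting [h Omega], which is what irreducibility asks to exclude.  The
    identity is added so that a greedy step discards the centre it chose. *)
Definition tile_separation (G : groupType) (Omega Delta : {fset G}) : {fset G} :=
  (1%g |` thickening [fset (w * d)%g | w in Omega, d in Delta] Omega)%fset.

(** Each window costs one dimension: irreducibility glues a translate of [x0]
    on it to zero on the later windows, so agreement with [Y] on the later
    windows never forces agreement on this one. *)
Lemma setdim_locally_in (G : groupType) (K : fieldType) (V : vectType K)
    (X Y : set (G -> V)) (x0 : G -> V) (Omega Delta F : {fset G}) (s : seq G) :
  submod_closed (mem X) -> (forall g x, X x -> X (gshift g x)) ->
  irreducible_for Delta X ->
  submod_closed (mem Y) -> (forall g y, Y y -> Y (gshift g y)) ->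
  X x0 -> ~ (exists2 y, Y y & {in Omega, y =1 x0}) ->
  {subset s <= tile_centers Omega F} ->
  pairwise (fun a b => b \notin ltranslate a (tile_separation Omega Delta)) s ->
  (setdim (@restriction G V F @` locally_in Y Omega s X) + size s
    <= setdim (@restriction G V F @` X))%N.
Proof.
move=> sX iX irrX sY iY Xx0 nYx0; elim: s => [_ _|g s IH sF].
  rewrite addn0; apply: leq_setdim; try apply: restriction_submod => //.
    exact: locally_in_submod.
  by apply: image_subset => x [].
rewrite pairwise_cons => /andP[/allP gs sD].
have {}IH := IH (fun h hs => sF h (mem_behead (s := g :: s) hs)) sD.
apply: leq_trans IH; rewrite addnS -addSn leq_add2r.
apply: ltn_setdim; try by apply: restriction_submod; apply: locally_in_submod.
have [X0 Xl] := (submod_closedP _).1 sX; have [Y0 Yl] := (submod_closedP _).1 sY.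
split.
  apply: image_subset => x [Xx xY]; split => // h hs; apply: xY.
  by rewrite inE hs orbT.
(* The witness: the translate of [x0] on the new window, zero on the others. *)
have [] := irrX [fset (h * w)%g | h in s, w in Omega]%fset (ltranslate g Omega) _
  0 (gshift g x0) X0 (iX g x0 Xx0).
  move=> [_ /imfsetP[w /= wO ->]] /fset0Pn[k]; rewrite inE.
  move=> /andP[/imfsetP[d /= dD ->] /imfset2P[h /= hs [w' /= wO' e]]].
  have /negP := gs _ hs; apply.
  apply/imfsetP; exists (w * d * w'^-1)%g; last by rewrite /= !mulgA e mulgK.
  rewrite !inE; apply/orP; right; apply/imfset2P; exists (w * d)%g.
    by apply/imfset2P; exists w => //; exists d.
  by exists w'.
(* If it agreed on [F] with some [z] that is in [Y] on the new window, then [Y]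
   would contain, up to translation, the pattern of [x0] on [Omega]. *)
have gO h : h \in Omega -> (g * h)%g \in ltranslate g Omega.
  by move=> hO; apply/imfsetP; exists h.
move=> x Xx [x_s x_g] /(_ (restriction F x)) /=.
case=> [|z [Xz zY] zx].
  exists x => //; split => // h hs; exists 0 => // k /imfsetP[w /= wO ->].
  by rewrite x_s //; apply/imfset2P; exists h => //; exists w.
have [y Yy zy] := zY g (mem_head _ _); apply: nYx0.
exists (gshift g^-1%g y); first exact: iY.
move=> h hO; rewrite /gshift invgK -zy ?gO //.
have := sF g (mem_head _ _); rewrite !inE /= => /andP[_ /fsubsetP gF].
have /ffunP/(_ [` gF _ (gO _ hO)]%fset) := zx; rewrite !ffunE /= => ->.
by rewrite x_g ?gO // /gshift mulKg.
Qed.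

(** * Upper limits along nets *)

(** The bounds keep both upper limits finite; with value +oo on both sides a
    gap of [e] would not separate them. *)
Lemma net_limsup_lt (R : realType) (d : Order.disp_t) (J : preorderType d)
    (u v : J -> R) (e M : R) :
  directed J -> 0 < e -> (forall j, 0 <= u j) -> (forall j, v j <= M) ->
  tails J [set j | u j + e <= v j] ->
  (net_limsup (fun j => (u j)%:E) < net_limsup (fun j => (v j)%:E))%E.
Proof.
move=> [[j0 _] dirJ] e0 u0 vM [i0 _ uv]; rewrite !net_limsupE.
set su := ereal_inf _; set sv := ereal_inf _.
have suv : (su + e%:E <= sv)%E.
  apply: le_ereal_inf_tmp => _ [i _ <-].
  have [k [i0k ik]] := dirJ i0 i.
  rewrite -leeBrDr //.
  apply: (@le_trans _ _ (ereal_sup [set (u j)%:E | j in [set j | (k <= j)%O]])).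
    by apply: ereal_inf_lbound; exists k.
  apply: ge_ereal_sup => _ [j /= kj <-]; rewrite EFinN leeBrDr // -EFinD.
  apply: le_ereal_sup_tmp; exists (v j)%:E.
    by exists j => //=; exact: le_trans kj.
  by rewrite lee_fin; apply: uv; exact: le_trans kj.
have su0 : (0 <= su)%E.
  apply: le_ereal_inf_tmp => _ [i _ <-]; apply: le_ereal_sup_tmp.
  by exists (u i)%:E; [exists i => /= | rewrite lee_fin].
have svM : (sv <= M%:E)%E.
  apply: ge_ereal_inf; exists (ereal_sup [set (v j)%:E | j in [set j | (j0 <= j)%O]]).
    by exists j0.
  by apply: ge_ereal_sup => _ [j _ <-]; rewrite lee_fin.
apply: (lt_le_trans _ suv); rewrite lteDl ?lte_fin //.
rewrite ge0_fin_numE //.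
rewrite (le_lt_trans _ (ltry M)) // (le_trans _ svM) //; apply: le_trans suv.
by rewrite leeDl // lee_fin ltW.
Qed.

Lemma tails_filter (d : Order.disp_t) (J : preorderType d) :
  directed J -> Filter (tails J).
Proof.
move=> [[j0 _] dirJ]; apply: filter_from_filter; first by exists j0.
move=> i j _ _; have [k [ik jk]] := dirJ i j.
by exists k => // l /= kl; split; exact: le_trans kl.
Qed.

Theorem proposition3p2 (R : realType) (G : groupType) (hG : amenable R G)
  (d : Order.disp_t) (J : preorderType d) (F : J -> {fset G})
  (hF : right_folner_net R F)
  (K : fieldType) (V : vectType K) (X Y : set (G -> V))
  (hX : linear_subshift X) (hXirr : strongly_irreducible X)
  (hY : linear_subshift Y) (hYX : Y `<` X) :
  (mdim R F Y < mdim R F X)%E.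
Proof.
case: hX hY hXirr hF => sX iX _ [sY iY cY] [Delta irrX] [dirJ F0 bdF].
case: hYX => YX nXY.
have [x0 Xx0 nYx0] : exists2 x0, X x0 & ~ Y x0.
  apply: contrapT => nex; apply: nXY => x Xx; apply: contrapT => nYx.
  by apply: nex; exists x.
have [ Omega sep] := closed_prodiscrete_separated cY nYx0.
pose D := tile_separation Omega Delta.
have D1 : 1%g \in D by rewrite !inE eqxx.
have D0 : 0 < #|` D|%:R :> R by rewrite ltr0n cardfs_gt0; apply/fset0Pn; exists 1%g.
pose B j := (thickening (F j) [fset w^-1 | w in Omega]%g `\` F j)%fset.
(* [setdim_locally_in] for a greedy family of windows in [F j]. *)
have drop j : (#|` F j|%:R - #|` Omega|%:R * #|` B j|%:R) / #|` D|%:R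
     + (setdim (@restriction G V (F j) @` Y))%:R
   <= (setdim (@restriction G V (F j) @` X))%:R :> R.
  have [s [sF sD Is]] := greedy_packing (tile_centers Omega (F j)) D1.
  have FI := card_tile_centers Omega (F j).
  have dX := setdim_locally_in sX iX irrX sY iY Xx0 sep sF sD.
  have dY : (setdim (@restriction G V (F j) @` Y) <=
      setdim (@restriction G V (F j) @` locally_in Y Omega s X))%N.
    apply: leq_setdim; try apply: restriction_submod => //.
      exact: locally_in_submod.
    apply: image_subset => y Yy; split; first exact: YX.
    by move=> g _; exists y.
  have {dX dY} : (size s + setdim (@restriction G V (F j) @` Y)
     <= setdim (@restriction G V (F j) @` X))%N.
    by rewrite addnC (leq_trans _ dX) // leq_add2r.
  rewrite -(ler_nat R) natrD; apply: le_trans; rewrite lerD2r.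
  rewrite ler_pdivrMr // lerBlDr -!natrM -natrD ler_nat.
  by apply: leq_trans FI _; rewrite leq_add2r.
have Fpos j : 0 < #|` F j|%:R :> R by rewrite ltr0n cardfs_gt0.
apply: (@net_limsup_lt _ _ _ _ _ ((#|` D|%:R)^-1 / 2) (dim V)%:R) => //.
- by rewrite divr_gt0 ?invr_gt0.
- move=> j; rewrite ler_pdivrMr // -natrM ler_nat.
  by rewrite (leq_trans (setdim_le_dim _)) // mulnC /dim /= -cardfE.
(* Once the relative boundary is below this constant, at least half of [F j]
   consists of centres; hence the factor 1/2 in the gap [1 / (2 #|D|)]. *)
have O0 : 0 < (2 * (#|` Omega|%:R + 1))^-1 :> R by rewrite invr_gt0 mulr_gt0 // ltr_wpDl.
have tF := tails_filter dirJ.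
have /cvgr_lt/(_ _ O0) := bdF [fset w^-1 | w in Omega]%g%fset.
apply: filterS => j /=; rewrite -/(B j) => bj.
apply: le_trans _ (ler_wpM2r _ (drop j)); last by rewrite invr_ge0 ltW.
rewrite mulrDl addrC lerD2r.
rewrite ler_pdivlMr // ler_pdivlMr //.
have -> : #|` D|%:R^-1 / 2 * #|` F j|%:R * #|` D|%:R = #|` F j|%:R / 2 :> R.
  by field; rewrite lt0r_neq0.
move: bj; rewrite ltr_pdivrMr // mulrC ltr_pdivlMr ?mulr_gt0 // ?ltr_wpDl //.
have : 0 <= #|` B j|%:R :> R by [].
move: #|` B j|%:R #|` F j|%:R #|` Omega|%:R => b f w; nra.
Qed.
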